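(* Let $\{u_1,\ldots,u_r\}\subset\mathcal E$ be a set of differential indeterminates over $\mathcal F$, and let $P_i(\mathbb U,\mathbb Y)\in\mathcal F\{\mathbb U,\mathbb Y\}$ $(i=1,\ldots,m)$ be differential polynomials in the differential indeterminates $\mathbb U=(u_1,\ldots,u_r)$ and $\mathbb Y=(y_1,\ldots,y_n)$. Let $\overline{\mathbb Y}=(\overline y_1,\ldots,\overline y_n)$ with $\overline y_i\in\mathcal E$ differentially free from $\mathcal F\langle\mathbb U\rangle$. If $P_i(\mathbb U,\overline{\mathbb Y})$ $(i=1,\ldots,m)$ are differentially dependent over $\mathcal F\langle\mathbb U\rangle$, then for any specialization of $\mathbb U$ to $\overline{\mathbb U}$ in $\mathcal F^r$, the elements $P_i(\overline{\mathbb U},\overline{\mathbb Y})$ $(i=1,\ldots,m)$ are differentially dependent over $\mathcal F$.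
   Context: $\mathcal F$ is an ordinary differential field of characteristic $0$ with derivation $\delta$ and $\mathcal E$ a fixed universal differential extension field of $\mathcal F$. A set $\Sigma$ is differentially dependent over a differential field $\mathcal G$ if the set of all derivatives of all elements of $\Sigma$ is algebraically dependent over $\mathcal G$. ''$\overline{\mathbb Y}$ differentially free from $\mathcal F\langle\mathbb U\rangle$'' means that $u_1,\dots,u_r$ are differential indeterminates (differentially independent) over $\mathcal F\langle\overline{\mathbb Y}\rangle$. *)

(* Defs.v *)
From HB Require Import structures.
From mathcomp Require Import all_boot all_algebra.
From mathcomp Require Import mpoly.
Set Implicit Arguments. Unset Strict Implicit. Unset Printing Implicit Defensive.
Import GRing.Theory.
Local Open Scope ring_scope.

Definition is_derivation (E : fieldType) (d : E -> E) : Prop :=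
  (forall x y, d (x + y) = d x + d y) /\ (forall x y, d (x * y) = d x * y + x * d y).

Definition is_diff_subfield (E : fieldType) (d : E -> E) (G : E -> Prop) : Prop :=
  G 0 /\ G 1 /\ (forall x y, G x -> G y -> G (x - y)) /\
  (forall x y, G x -> G y -> G (x * y)) /\
  (forall x, G x -> G x^-1) /\ (forall x, G x -> G (d x)).

Definition diff_gen (E : fieldType) (d : E -> E) (G : E -> Prop) (k : nat)
    (w : 'I_k -> E) : E -> Prop :=
  fun x => forall S : E -> Prop, is_diff_subfield d S ->
    (forall y, G y -> S y) -> (forall j, S (w j)) -> S x.

Definition ext (E : fieldType) (k : nat) (w : 'I_k -> E) (j : nat) : E :=
  match (insub j : option 'I_k) with Some i => w i | None => 0 end.

Definition zcat (E : fieldType) (r n : nat) (z : 'I_r -> E) (y : 'I_n -> E)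
    (j : nat) : E :=
  if (j < r)%N then ext z j else ext y (j - r).

(* Valuation of the polynomial variables encoding derivatives up to order h:
   variable t (t < k * h.+1) stands for the (t %% h.+1)-th derivative of the
   (t %/ h.+1)-th differential indeterminate. *)
Definition dvals (E : fieldType) (d : E -> E) (k h : nat) (z : nat -> E)
    : 'I_(k * h.+1) -> E :=
  fun t => iter ((t : nat) %% h.+1)%N d (z ((t : nat) %/ h.+1)%N).

Arguments dvals {E} d {k} h z.

Definition coef_in (E : fieldType) (k : nat) (G : E -> Prop) (Q : {mpoly E[k]}) : Prop :=
  forall mo, G (Q@_mo).

Definition diff_dependent (E : fieldType) (d : E -> E) (G : E -> Prop) (m : nat)
    (w : 'I_m -> E) : Prop :=
  exists h : nat, exists Q : {mpoly E[m * h.+1]},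
    [/\ Q != 0, coef_in G Q & Q.@[dvals d h (ext w)] = 0].

(* Main.v *)
(** Put [K = F<ybar>] and [t = u - ubar], so that [t] is again differentially
    independent over [K].  After clearing denominators the given dependence
    reads [sum_mo p_mo * W^mo = 0], where the [p_mo] are differential
    polynomials in [t] over [F] and the components of [W], the derivatives of
    the [P_i(U, ybar)], are differential polynomials in [t] over [K] whose
    constant terms are the derivatives of the [P_i(ubar, ybar)].  By
    independence of [t] this is an identity of polynomials.  Let [k] be a
    monomial of least degree occurring in some [p_mo]: the coefficient of [k]
    in the identity only involves the constant term of [W^mo], and is the
    required relation over [F]. *)

Require Import Defs.
From HB Require Import structures.
From mathcomp Require Import all_boot all_algebra.
From mathcomp Require Import mpoly.
Set Implicit Arguments.
Unset Strict Implicit.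
Import GRing.Theory.
Local Open Scope ring_scope.

(** * Derivations and differential subfields *)

Lemma derivation0 (E : fieldType) (d : E -> E) : is_derivation d -> d 0 = 0.
Proof. by move=> [dD _]; apply: (addrI (d 0)); rewrite -dD !addr0. Qed.

Lemma derivationN (E : fieldType) (d : E -> E) x :
  is_derivation d -> d (- x) = - d x.
Proof.
move=> hd; apply: (addrI (d x)).
by rewrite -(proj1 hd) !subrr (derivation0 hd).
Qed.

Lemma derivation1 (E : fieldType) (d : E -> E) : is_derivation d -> d 1 = 0.
Proof.
move=> [_ dM]; apply: (addrI (d 1)); rewrite addr0.
by rewrite -[in RHS](mulr1 1) dM mulr1 mul1r.
Qed.

Lemma derivation_div (E : fieldType) (d : E -> E) a b :
  is_derivation d -> b != 0 -> d (a / b) = (d a * b - a * d b) / (b * b).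
Proof.
move=> hd b0; have [_ dM] := hd.
have dV : d b * b^-1 + b * d b^-1 = 0.
  by rewrite -dM divff // (derivation1 hd).
rewrite dM mulrBl invfM; congr (_ + _).
  by rewrite mulrACA divff // mulr1.
have -> : d b^-1 = b^-1 * (b * d b^-1) by rewrite mulKf.
move/eqP: dV; rewrite addrC addr_eq0 => /eqP ->.
by rewrite !mulrN [b^-1 * (_ * _)]mulrCA !mulrA.
Qed.

Lemma iter_derivationB (E : fieldType) (d : E -> E) k x y :
  is_derivation d -> iter k d (x - y) = iter k d x - iter k d y.
Proof.
move=> hd; elim: k => //= k ->.
by rewrite (proj1 hd) derivationN.
Qed.

Lemma diff_subfieldN (E : fieldType) (d : E -> E) (G : E -> Prop) x :
  is_diff_subfield d G -> G x -> G (- x).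
Proof. by move=> [G0 [_ [GB _]]] Gx; rewrite -sub0r; apply: GB. Qed.

Lemma diff_subfieldD (E : fieldType) (d : E -> E) (G : E -> Prop) x y :
  is_diff_subfield d G -> G x -> G y -> G (x + y).
Proof.
move=> hG Gx Gy; rewrite -[y]opprK; apply: hG.2.2.1 => //.
exact: diff_subfieldN (hG) Gy.
Qed.

Lemma diff_subfield_iter (E : fieldType) (d : E -> E) (G : E -> Prop) k x :
  is_diff_subfield d G -> G x -> G (iter k d x).
Proof. by move=> hG Gx; elim: k => //= k; apply: hG.2.2.2.2.2. Qed.

Lemma diff_gen_subfield (E : fieldType) (d : E -> E) (G : E -> Prop) k
    (w : 'I_k -> E) : is_diff_subfield d (diff_gen d G w).
Proof.
split; first by move=> S [].
split; first by move=> S [_ []].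
split; first by move=> x y hx hy S hS GS wS; apply: hS.2.2.1; [apply: hx|apply: hy].
split; first by move=> x y hx hy S hS GS wS; apply: hS.2.2.2.1; [apply: hx|apply: hy].
split; first by move=> x hx S hS GS wS; apply: hS.2.2.2.2.1; apply: hx.
by move=> x hx S hS GS wS; apply: hS.2.2.2.2.2; apply: hx.
Qed.

(** * Polynomials with coefficients in a differential subfield *)

Lemma coef_in_sum (E : fieldType) (d : E -> E) (G : E -> Prop) (k : nat)
    (I : eqType) (s : seq I) (f : I -> {mpoly E[k]}) :
  is_diff_subfield d G -> (forall i, i \in s -> coef_in G (f i)) ->
  coef_in G (\sum_(i <- s) f i).
Proof.
move=> hG; elim: s => [|i s IH] hf mo; rewrite ?big_nil ?big_cons.
  by rewrite mcoeff0; apply: hG.1.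
rewrite mcoeffD; apply: diff_subfieldD (hG) _ _; first by apply: hf; rewrite mem_head.
by apply: IH => j js; apply: hf; rewrite inE js orbT.
Qed.

Lemma coef_inC (E : fieldType) (d : E -> E) (G : E -> Prop) (k : nat) c :
  is_diff_subfield d G -> G c -> coef_in G (c%:MP : {mpoly E[k]}).
Proof.
move=> [G0 _] Gc mo; rewrite mcoeffC.
by case: eqP => _; rewrite ?mulr1 ?mulr0.
Qed.

Lemma coef_inX (E : fieldType) (d : E -> E) (G : E -> Prop) (k : nat) mo :
  is_diff_subfield d G -> coef_in G ('X_[mo] : {mpoly E[k]}).
Proof. by move=> [G0 [G1 _]] mo'; rewrite mcoeffX; case: eqP. Qed.

Lemma coef_inD (E : fieldType) (d : E -> E) (G : E -> Prop) (k : nat)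
    (p q : {mpoly E[k]}) :
  is_diff_subfield d G -> coef_in G p -> coef_in G q -> coef_in G (p + q).
Proof. by move=> hG hp hq mo; rewrite mcoeffD; apply: diff_subfieldD (hG) _ _. Qed.

Lemma coef_inM (E : fieldType) (d : E -> E) (G : E -> Prop) (k : nat)
    (p q : {mpoly E[k]}) :
  is_diff_subfield d G -> coef_in G p -> coef_in G q -> coef_in G (p * q).
Proof.
move=> hG hp hq mo; rewrite mcoeffM; apply: (big_ind G).
- exact: hG.1.
- by move=> x y; apply: diff_subfieldD (hG).
- by move=> i _; apply: hG.2.2.2.1.
Qed.

Lemma coef_in_comp (E : fieldType) (d : E -> E) (G : E -> Prop) (k l : nat)
    (p : {mpoly E[k]}) (q : k.-tuple {mpoly E[l]}) :
  is_diff_subfield d G -> coef_in G p ->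
  (forall i, coef_in G (tnth q i)) -> coef_in G (p \mPo q).
Proof.
move=> hG hp hq; rewrite comp_mpolyE; apply: coef_in_sum (hG) _ => mo _.
rewrite -mul_mpolyC; apply: coef_inM (hG) _ _; first exact: coef_inC (hG) _.
have G1 : coef_in G (1 : {mpoly E[l]}).
  by rewrite -mpolyC1; apply: coef_inC (hG) hG.2.1.
apply: (big_ind (coef_in G)) => //; first by move=> x y; apply: coef_inM (hG).
move=> i _; elim: (mo i) => [|e IH]; first by rewrite expr0.
by rewrite exprS; apply: coef_inM (hG) _ _.
Qed.

(** Substitution is a ring morphism fixing constants, so it is enough to invert it on the variables.
    This keeps a polynomial nonzero under a translation of its variables. *)
Lemma comp_mpoly_cancel (R : comNzRingType) (k : nat) (p : {mpoly R[k]})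
    (q q' : k.-tuple {mpoly R[k]}) :
  (forall i, tnth q i \mPo q' = 'X_i) -> (p \mPo q) \mPo q' = p.
Proof.
move=> qK; rewrite (comp_mpolyEX p) raddf_sum [RHS]mpolyE /=.
apply: eq_bigr => mo _; rewrite comp_mpolyZ comp_mpolyX rmorph_prod /=.
congr (_ *: _); rewrite [RHS]mpolyXE_id; apply: eq_bigr => i _.
by rewrite rmorphXn /= qK.
Qed.

(** In the convolution for [mo], a monomial of [q] of positive degree leaves for [p] a monomial of
    degree below [mdeg mo], whose coefficient vanishes. *)
Lemma mcoeffM_lowest (R : comNzRingType) (k : nat) (p q : {mpoly R[k]}) mo :
  (forall mo', (mdeg mo' < mdeg mo)%N -> p@_mo' = 0) ->
  (p * q)@_mo = p@_mo * q@_0.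
Proof.
move=> low; rewrite mcoeffM.
have mo_lt : (mdeg mo < (mdeg mo).+1)%N by [].
have z_lt : (mdeg (0%MM : 'X_{1..k}) < (mdeg mo).+1)%N by rewrite mdeg0.
rewrite (bigD1 (BMultinom mo_lt, BMultinom z_lt)) /= ?addm0 //.
rewrite big1 ?addr0 // => -[[a ha] [b hb]] /= /andP[/eqP ab ne].
rewrite low ?mul0r // ab mdegD -[X in (X < _)%N]addn0 ltn_add2l lt0n mdeg_eq0.
apply: contraNN ne => /eqP b0; rewrite xpair_eqE -!val_eqE /=.
by rewrite ab b0 addm0 !eqxx.
Qed.

Lemma ext_ord (E : fieldType) k (w : 'I_k -> E) (j : 'I_k) : ext w j = w j.
Proof. by rewrite /ext valK. Qed.

Lemma extP (E : fieldType) k (w : 'I_k -> E) (R : E -> Prop) j :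
  R 0 -> (forall i, R (w i)) -> R (ext w j).
Proof. by rewrite /ext; case: insub. Qed.

(** No choice axiom enters: the function is built by recursion on the list, with equality tests on
    [A]. *)
Lemma finite_choice (A : eqType) (B : Type) (b0 : B) (s : seq A)
    (R : A -> B -> Prop) :
  (forall x, x \in s -> exists y, R x y) ->
  exists f, forall x, x \in s -> R x (f x).
Proof.
elim: s => [|a s IH] hR; first by exists (fun=> b0).
have [y Ry] := hR a (mem_head _ _).
have [x xs|f hf] := IH; first by apply: hR; rewrite inE xs orbT.
exists (fun x => if x == a then y else f x) => x; rewrite inE.
by case: eqP => [->|_] //= /hf.
Qed.

(** * Simultaneous values of differential polynomials at [t] and at [0] *)

(* [spec d K t H a b]: [a] is the value at [t] of a differential polynomial of
   order at most [H] over [K], and [b] is its value at [0]. *)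
Inductive spec (E : fieldType) (d : E -> E) (K : E -> Prop) (r : nat)
    (t : 'I_r -> E) (H : nat) : E -> E -> Prop :=
| spec_const c of K c : spec d K t H c c
| spec_der j k of (k <= H)%N : spec d K t H (iter k d (t j)) 0
| spec_add a a' b b' of spec d K t H a a' & spec d K t H b b' :
    spec d K t H (a + b) (a' + b')
| spec_mul a a' b b' of spec d K t H a a' & spec d K t H b b' :
    spec d K t H (a * b) (a' * b').

Lemma spec_mono (E : fieldType) (d : E -> E) (K : E -> Prop) (r : nat)
    (t : 'I_r -> E) H H' a b :
  (H <= H')%N -> spec d K t H a b -> spec d K t H' a b.
Proof.
move=> le; elim=> {a b} *; [exact: spec_const | | exact: spec_add | exact: spec_mul].
by apply: spec_der; apply: leq_trans le.
Qed.

(** Setting [t] and all its derivatives to [0] commutes with differentiation, and differentiation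
    raises the order by at most one. *)
Lemma spec_derivation (E : fieldType) (d : E -> E) (K : E -> Prop) (r : nat)
    (t : 'I_r -> E) H a b :
  is_derivation d -> is_diff_subfield d K ->
  spec d K t H a b -> spec d K t H.+1 (d a) (d b).
Proof.
move=> hd hK; elim=> {a b}.
- by move=> c Kc; apply: spec_const; apply: hK.2.2.2.2.2.
- by move=> j k le; rewrite (derivation0 hd) -iterS; apply: spec_der.
- by move=> a a' b b' _ IHa _ IHb; rewrite !(proj1 hd); apply: spec_add.
- move=> a a' b b' sa IHa sb IHb; rewrite !(proj2 hd).
  by apply: spec_add; apply: spec_mul => //; apply: spec_mono (leqnSn H) _.
Qed.

Lemma spec_iter (E : fieldType) (d : E -> E) (K : E -> Prop) (r : nat)
    (t : 'I_r -> E) H a b k :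
  is_derivation d -> is_diff_subfield d K ->
  spec d K t H a b -> spec d K t (H + k) (iter k d a) (iter k d b).
Proof.
move=> hd hK sab; elim: k => [|k IH]; first by rewrite addn0.
by rewrite addnS; apply: spec_derivation.
Qed.

Lemma spec_opp (E : fieldType) (d : E -> E) (K : E -> Prop) (r : nat)
    (t : 'I_r -> E) H a b :
  is_diff_subfield d K -> spec d K t H a b -> spec d K t H (- a) (- b).
Proof.
move=> hK sab; rewrite -mulN1r -(mulN1r b); apply: spec_mul => //.
by apply: spec_const; apply: diff_subfieldN (hK) hK.2.1.
Qed.

Lemma spec_monomial (E : fieldType) (d : E -> E) (K : E -> Prop) (r : nat)
    (t : 'I_r -> E) H l (v v' : 'I_l -> E) (mo : 'X_{1..l}) :
  is_diff_subfield d K -> (forall i, spec d K t H (v i) (v' i)) ->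
  spec d K t H (\prod_i v i ^+ mo i) (\prod_i v' i ^+ mo i).
Proof.
move=> hK hv; have s1 : spec d K t H 1 1 by apply: spec_const; apply: hK.2.1.
apply: (big_ind2 (spec d K t H)) => // [*|i _]; first exact: spec_mul.
elim: (mo i) => [|e IH]; first by rewrite !expr0.
by rewrite !exprS; apply: spec_mul.
Qed.

Lemma spec_meval (E : fieldType) (d : E -> E) (K : E -> Prop) (r : nat)
    (t : 'I_r -> E) H l (v v' : 'I_l -> E) (p : {mpoly E[l]}) :
  is_diff_subfield d K -> coef_in K p ->
  (forall i, spec d K t H (v i) (v' i)) ->
  spec d K t H p.@[v] p.@[v'].
Proof.
move=> hK hp hv; rewrite !mevalE; apply: (big_ind2 (spec d K t H)).
- by apply: spec_const; apply: hK.1.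
- by move=> *; apply: spec_add.
- by move=> mo _; apply: spec_mul; [apply: spec_const | apply: spec_monomial].
Qed.

(** Realizes both values by one polynomial, the value at [0] being its constant coefficient;
    independence of [t] can then be applied to it. *)
Lemma spec_mpoly (E : fieldType) (d : E -> E) (K : E -> Prop) (r : nat)
    (t : 'I_r -> E) H a b :
  is_diff_subfield d K -> spec d K t H a b ->
  exists p : {mpoly E[r * H.+1]},
    [/\ coef_in K p, p.@[dvals d H (ext t)] = a & p@_0 = b].
Proof.
move=> hK; elim=> {a b}.
- move=> c Kc; exists c%:MP.
  by split; [exact: coef_inC (hK) Kc | rewrite mevalC | rewrite mcoeffC eqxx mulr1].
- move=> j k le.
  (* The number of the variable encoding the [k]-th derivative of [t j]; [dvals] recovers [j] and
     [k] by division, since [k <= H]. *)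
  have lt : (j * H.+1 + k < r * H.+1)%N.
    apply: (@leq_trans (j.+1 * H.+1)); last by rewrite leq_mul2r ltn_ord orbT.
    by rewrite mulSn addnC ltn_add2r.
  exists 'X_(Ordinal lt); split; first exact: coef_inX (hK).
    rewrite mevalXU /dvals /= modnMDl modn_small // divnMDl // divn_small //.
    by rewrite addn0 ext_ord.
  by rewrite mcoeffX -mdeg_eq0 mdeg1.
- move=> a a' b b' _ [p [hp <- <-]] _ [q [hq <- <-]]; exists (p + q).
  by split; [exact: coef_inD (hK) hp hq | rewrite mevalD | rewrite mcoeffD].
- move=> a a' b b' _ [p [hp <- <-]] _ [q [hq <- <-]]; exists (p * q).
  split; [exact: coef_inM (hK) hp hq | by rewrite mevalM |].
  (* At the monomial [0] the condition on lower degrees is vacuous. *)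
  by rewrite mcoeffM_lowest // => mo; rewrite mdeg0.
Qed.

(** * Fractions of differential polynomials and common denominators *)

Definition frac (E : fieldType) (d : E -> E) (F : E -> Prop) (r : nat)
    (t : 'I_r -> E) (x : E) : Prop :=
  exists H a b a' b',
    [/\ spec d F t H a a', spec d F t H b b', b != 0 & x = a / b].

(** [diff_gen] is an intersection, so it suffices that [frac d F t] is a differential subfield
    containing [F] and the [u j]. *)
Lemma diff_gen_frac (E : fieldType) (d : E -> E) (F : E -> Prop) (r : nat)
    (u t : 'I_r -> E) x :
  is_derivation d -> is_diff_subfield d F -> (forall j, F (u j - t j)) ->
  diff_gen d F u x -> frac d F t x.
Proof.
move=> hd hF hut hx; apply: (hx (frac d F t)); last first.
- move=> j; exists 0%N, (u j), 1, (u j - t j + 0), 1.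
  rewrite divr1 oner_neq0; split=> //; last exact/spec_const/hF.2.1.
  rewrite -{1}[u j](subrK (t j)); apply: spec_add; first exact: spec_const.
  exact: (@spec_der _ _ _ _ _ _ j 0%N).
- move=> y Fy; exists 0%N, y, 1, y, 1.
  by rewrite divr1 oner_neq0; split=> //; apply: spec_const => //; apply: hF.2.1.
have s1 H : spec d F t H 1 1 by apply: spec_const; apply: hF.2.1.
have s0 H : spec d F t H 0 0 by apply: spec_const; apply: hF.1.
split; first by exists 0%N, 0, 1, 0, 1; rewrite mul0r oner_neq0.
split; first by exists 0%N, 1, 1, 1, 1; rewrite divr1 oner_neq0.
have ml H1 H2 := @spec_mono _ d F r t _ _ _ _ (leq_addr H2 H1).
have mr H1 H2 := @spec_mono _ d F r t _ _ _ _ (leq_addl H1 H2).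
split.
  move=> x1 x2 [H1 [a1 [b1 [a1' [b1' [sa1 sb1 n1 ->]]]]]].
  move=> [H2 [a2 [b2 [a2' [b2' [sa2 sb2 n2 ->]]]]]].
  exists (H1 + H2)%N, (a1 * b2 - a2 * b1), (b1 * b2),
    (a1' * b2' + - (a2' * b1')), (b1' * b2'); split.
  - apply: spec_add; last apply: spec_opp (hF) _.
      by apply: spec_mul; [apply: ml | apply: mr].
    by apply: spec_mul; [apply: mr | apply: ml].
  - by apply: spec_mul; [apply: ml | apply: mr].
  - by rewrite mulf_neq0.
  - by rewrite -mulNr addf_div // mulNr.
split.
  move=> x1 x2 [H1 [a1 [b1 [a1' [b1' [sa1 sb1 n1 ->]]]]]].
  move=> [H2 [a2 [b2 [a2' [b2' [sa2 sb2 n2 ->]]]]]].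
  exists (H1 + H2)%N, (a1 * a2), (b1 * b2), (a1' * a2'), (b1' * b2').
  split; rewrite ?mulf_neq0 ?mulf_div //.
    by apply: spec_mul; [apply: ml | apply: mr].
  by apply: spec_mul; [apply: ml | apply: mr].
split.
  move=> x1 [H [a [b [a' [b' [sa sb nb ->]]]]]].
  (* If [a = 0], swapping numerator and denominator is not allowed; the inverse is then [0] by
     convention. *)
  have [->|na] := eqVneq a 0.
    by exists 0%N, 0, 1, 0, 1; rewrite !mul0r invr0 oner_neq0.
  by exists H, b, a, b', a'; rewrite invf_div.
move=> x1 [H [a [b [a' [b' [sa sb nb ->]]]]]].
have sda := spec_derivation hd hF sa; have sdb := spec_derivation hd hF sb.
have {}sa := spec_mono (leqnSn H) sa; have {}sb := spec_mono (leqnSn H) sb.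
exists H.+1, (d a * b - a * d b), (b * b), (d a' * b' + - (a' * d b')), (b' * b').
split; [|exact: spec_mul|by rewrite mulf_neq0|exact: derivation_div].
by apply: spec_add; [exact: spec_mul | apply/(spec_opp hF)/spec_mul].
Qed.

(** The product of the individual denominators serves as [B]. *)
Lemma diff_gen_common_denominator (E : fieldType) (d : E -> E) (F : E -> Prop)
    (r : nat) (u t : 'I_r -> E) (s : seq E) :
  is_derivation d -> is_diff_subfield d F -> (forall j, F (u j - t j)) ->
  (forall x, x \in s -> diff_gen d F u x) ->
  exists H B B', [/\ spec d F t H B B', B != 0 &
    forall x, x \in s -> exists c, spec d F t H (B * x) c].
Proof.
move=> hd hF hut; elim: s => [|x s IH] hs.
  exists 0%N, 1, 1; rewrite oner_neq0; split=> //.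
  by apply: spec_const; apply: hF.2.1.
have [y ys|H1 [B [B' [sB nB hB]]]] := IH.
  by apply: hs; rewrite inE ys orbT.
have [H2 [a [b [a' [b' [sa sb nb xE]]]]]] :=
  diff_gen_frac hd hF hut (hs _ (mem_head _ _)).
have {}sB := spec_mono (leq_addr H2 H1) sB.
have {}sa := spec_mono (leq_addl H1 H2) sa.
have {}sb := spec_mono (leq_addl H1 H2) sb.
exists (H1 + H2)%N, (B * b), (B' * b'); split; first exact: spec_mul.
  by rewrite mulf_neq0.
move=> y; rewrite inE => /predU1P[->|/hB[c sc]].
  exists (B' * a').
  have -> : B * b * x = B * a by rewrite xE -mulrA [b * _]mulrC divfK.
  exact: spec_mul.
exists (b' * c); rewrite mulrAC mulrC; apply: spec_mul => //.
exact: spec_mono (leq_addr H2 H1) sc.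
Qed.

(** * Translation of the indeterminates by elements of the base field *)

(** Substituting [X_i - C_i], with [C_i] the matching derivative of [c], is invertible, and its
    coefficients stay in [K] because [K] is closed under [d]. *)
Lemma diff_dependent_translate (E : fieldType) (d : E -> E) (K : E -> Prop)
    (r : nat) (u c : 'I_r -> E) :
  is_derivation d -> is_diff_subfield d K -> (forall j, K (c j)) ->
  diff_dependent d K (fun j => u j - c j) -> diff_dependent d K u.
Proof.
move=> hd hK Kc [H [Q [nQ hQ Q0]]].
pose C : 'I_(r * H.+1) -> E := dvals d H (ext c).
have KC i : K (C i).
  by apply: (diff_subfield_iter _ hK); apply: extP => //; apply: hK.1.
pose q := [tuple 'X_i - (C i)%:MP | i < r * H.+1].
exists H, (Q \mPo q); split.
- apply: contraNneq nQ => Qq0.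
  rewrite -(@comp_mpoly_cancel _ _ Q q [tuple 'X_i + (C i)%:MP | i < r * H.+1]).
    by rewrite Qq0 raddf0.
  move=> i; rewrite tnth_mktuple raddfB /= comp_mpolyC comp_mpolyXU.
  by rewrite -tnth_nth tnth_mktuple addrK.
- apply: coef_in_comp (hK) hQ _ => i; rewrite tnth_mktuple.
  apply: coef_inD (hK) _ _; first exact: coef_inX (hK).
  by rewrite -mpolyCN; apply: coef_inC (hK) _; apply: diff_subfieldN (hK) _.
- rewrite comp_mpoly_meval -[RHS]Q0; apply: meval_eq => i.
  rewrite tnth_mktuple mevalB mevalXU mevalC /C /dvals -iter_derivationB //.
  by congr (iter _ d _); rewrite /ext; case: insub; rewrite ?subrr.
Qed.

(** Writing [u j] as [(u j - c j) + c j] exhibits it as a polynomial of order [0] with value [c j]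
    at [0]; the entries of [y] are constants in [K]. *)
Lemma spec_zcat (E : fieldType) (d : E -> E) (K : E -> Prop) (r n h : nat)
    (u c : 'I_r -> E) (y : 'I_n -> E) (p : {mpoly E[(r + n) * h.+1]}) :
  is_derivation d -> is_diff_subfield d K ->
  coef_in K p -> (forall j, K (c j)) -> (forall i, K (y i)) ->
  spec d K (fun j => u j - c j) h
    p.@[dvals d h (zcat u y)] p.@[dvals d h (zcat c y)].
Proof.
move=> hd hK hp Kc Ky; apply: spec_meval => // i; rewrite /dvals.
have le : (i %% h.+1 <= h)%N by rewrite -ltnS ltn_pmod.
apply: spec_mono le _; rewrite -[X in spec _ _ _ X]add0n; apply: spec_iter => //.
rewrite /zcat; case: ifP => [lt|_]; last first.
  by apply: spec_const; apply: extP => //; apply: hK.1.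
rewrite -[(i %/ _)%N]/(nat_of_ord (Ordinal lt)) !ext_ord; move: (Ordinal lt) => j.
rewrite -{1}(subrK (c j) (u j)) -[X in spec _ _ _ _ _ X]add0r.
apply: spec_add; last exact: spec_const.
exact: (@spec_der _ _ _ _ _ _ j 0%N).
Qed.

(** * Extraction of the relation of lowest degree *)

Theorem theorem2p16 (E : fieldType) (d : E -> E) (F : E -> Prop)
  (hd : is_derivation d) (hchar : [pchar E] =i pred0)
  (hF : is_diff_subfield d F)
  (r n m h : nat) (u : 'I_r -> E) (ybar : 'I_n -> E)
  (P : 'I_m -> {mpoly E[(r + n) * h.+1]})
  (hPF : forall i, coef_in F (P i))
  (hu : ~ diff_dependent d F u)
  (hyfree : ~ diff_dependent d (diff_gen d F ybar) u)
  (hdep : diff_dependent d (diff_gen d F u)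
            (fun i => (P i).@[dvals d h (zcat u ybar)])) :
  forall ubar : 'I_r -> E, (forall j, F (ubar j)) ->
    diff_dependent d F (fun i => (P i).@[dvals d h (zcat ubar ybar)]).
Proof.
move=> ubar Fubar; set K := diff_gen d F ybar in hyfree.
have hK : is_diff_subfield d K by apply: diff_gen_subfield.
have FK x : F x -> K x by move=> Fx S _ FS _; apply: FS.
have Ky i : K (ybar i) by move=> S _ _; apply.
pose t j := u j - ubar j.
have tfree : ~ diff_dependent d K t.
  by move=> /(diff_dependent_translate hd hK (fun j => FK _ (Fubar j))).
case: hdep => h' [Q [nQ hQ Q0]]; exists h'.
set w := dvals _ _ _ in Q0; set w' := dvals _ _ _.
have [j|x xs|H0 [B [_ [_ nB hB]]]] :=
    @diff_gen_common_denominator _ d F r u t [seq Q@_mo | mo <- msupp Q] hd hF.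
- by rewrite /t opprB addrC subrK.
- by case/mapP: xs => mo _ ->.
(* [H0] bounds the order of the cleared coefficients; [h + h'] bounds that of derivatives up to
   order [h'] of polynomials of order [h]. *)
pose H := (H0 + (h + h'))%N.
have spec_w i : spec d K t H (w i) (w' i).
  apply: spec_mono (leq_addl _ _) _; rewrite /w /w' /dvals.
  have le : (i %% h'.+1 <= h')%N by rewrite -ltnS ltn_pmod.
  apply: (@spec_mono _ _ _ _ _ (h + i %% h'.+1)); first by rewrite leq_add2l.
  apply: spec_iter => //; rewrite /ext.
  case: insub => [j|]; last exact: spec_const hK.1.
  by apply: spec_zcat => // [mo|j']; apply: FK; [exact: hPF | exact: Fubar].
(* The polynomials [p mo] representing the cleared coefficients have coefficients in [F], not just
   in [K]; this puts the final relation over [F]. *)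
have [mo|p hp] := @finite_choice _ {mpoly E[r * H.+1]} 0 (msupp Q)
    (fun mo q => coef_in F q /\ q.@[dvals d H (ext t)] = B * Q@_mo).
- move=> /(map_f (fun mo => Q@_mo))/hB[c sc].
  have [q [Fq qE _]] := spec_mpoly hF (spec_mono (leq_addr (h + h') H0) sc).
  by exists q.
(* [g mo] represents the monomial [mo] in the components of [w], with the same monomial in [w'] as
   constant term. *)
have [mo _|g hg] := @finite_choice _ {mpoly E[r * H.+1]} 0 (msupp Q)
    (fun mo q => [/\ coef_in K q,
      q.@[dvals d H (ext t)] = \prod_i w i ^+ mo i
      & q@_0 = \prod_i w' i ^+ mo i]).
- exact/(spec_mpoly hK)/spec_monomial.
(* At [t] the sum takes the value [B * Q.@[w] = 0], so a nonzero sum would make [t] dependent over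
   [K]. *)
have sum0 : \sum_(mo <- msupp Q) p mo * g mo = 0.
  apply/eqP/negPn/negP => nz; apply: tfree; exists H.
  exists (\sum_(mo <- msupp Q) p mo * g mo); split=> //.
    apply: coef_in_sum (hK) _ => mo /[dup] /hp [Fp _] /hg [Kg _ _].
    by apply: coef_inM (hK) _ Kg => k; apply: FK.
  rewrite raddf_sum /= -[RHS](mulr0 B) -[in RHS]Q0 mevalE mulr_sumr.
  apply: eq_big_seq => mo /[dup] /hp [_ pE] /hg [_ gE _].
  by rewrite mevalM pE gE mulrA.
pose low l := has (fun mo => has (fun k => mdeg k == l) (msupp (p mo))) (msupp Q).
have ex_low : exists l, low l.
  have /hp[_ pE] := mlead_supp nQ.
  (* Its value at [t] is [B] times the leading coefficient of [Q], a product of nonzero factors. *)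
  have np : p (mlead Q) != 0.
    apply/eqP => p0; move/eqP: pE.
    by rewrite p0 meval0 eq_sym mulf_eq0 (negPf nB) mleadc_eq0 (negPf nQ).
  exists (mdeg (mlead (p (mlead Q)))); apply/hasP.
  exists (mlead Q); first exact: mlead_supp.
  by apply/hasP; exists (mlead (p (mlead Q))); first exact: mlead_supp.
case: (ex_minnP ex_low) => _ /hasP[mo0 mo0Q /hasP[k kp /eqP <-]] k_min.
(* The coefficient of [k] is taken in every [p mo]; at [mo0] it is nonzero, since [k] lies in the
   support of [p mo0]. *)
pose Q' := \sum_(mo <- msupp Q) (p mo)@_k *: 'X_[mo] : {mpoly E[m * h'.+1]}.
exists Q'; split.
- apply: contraTneq kp => /(congr1 (mcoeff mo0)); rewrite mcoeff0 raddf_sum /=.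
  rewrite (bigD1_seq mo0) ?msupp_uniq //= big1 => [|mo /negPf ne].
    by rewrite addr0 mcoeffZ mcoeffX eqxx mulr1 mcoeff_msupp negbK => ->.
  by rewrite mcoeffZ mcoeffX ne mulr0.
- apply: coef_in_sum (hF) _ => mo /hp[Fp _]; rewrite -mul_mpolyC.
  by apply: coef_inM (hF) _ _; [apply: coef_inC (hF) _ | apply: coef_inX (hF)].
(* The coefficient of [k] in [sum0] is compared termwise: by minimality no [p mo] has a monomial of
   degree below [mdeg k], so only the constant term of [g mo] contributes. *)
- rewrite -[RHS](mcoeff0 _ k) -[in RHS]sum0 !raddf_sum /=.
  apply: eq_big_seq => mo moQ; have [_ _ gE] := hg mo moQ.
  rewrite mevalZ mevalX mcoeffM_lowest ?gE // => k'; rewrite ltnNge => lt.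
  apply: memN_msupp_eq0; apply: contraNN lt => k'p; apply: k_min.
  by apply/hasP; exists mo => //; apply/hasP; exists k'.
Qed.
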